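(* Let $q\in\mathbb{C}$ with $|q|<1$, and let $a,b,c,d$ be complex numbers with $|a|<1$ and $|c|<1$. Let $f(z)$ be an analytic function on $|z|<1$ with power series $f(z)=\sum_{j=0}^\infty \lambda_j z^j$ for $|z|<1$. Then $$\sum_{n=0}^{\infty}\frac{(b/a)_n a^n}{(d)_n}f(cq^n)=\sum_{j=0}^{\infty}\lambda_j c^j\sum_{n=0}^{\infty}\frac{(ad/b)_n(-b)^nq^{\binom{n}{2}+jn}}{(d)_n(aq^j)_{n+1}}.$$
   Context: For $x\in\mathbb{C}$ the $q$-Pochhammer symbols are $(x)_0=(x;q)_0=1$, $(x)_n=(x;q)_n=(1-x)(1-xq)\cdots(1-xq^{n-1})$ for $n\ge 1$, and $(x)_\infty=\lim_{n\to\infty}(x)_n$. Throughout $|q|<1$. *)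

(* Defs.v *)
From Stdlib Require Export Reals.
From Coquelicot Require Export Coquelicot.

Open Scope C_scope.

Fixpoint qpoch (x q : C) (n : nat) : C :=
  match n with
  | O => 1
  | S m => qpoch x q m * (1 - x * q ^ m)
  end.

(* Coquelicot's [Series] is real-valued, so complex sums are stated
   relationally.  The scalar field is fixed to C because C also carries a
   normed-module structure over R. *)
Definition is_Cseries (u : nat -> C) (s : C) : Prop :=
  @is_series C_AbsRing C_NormedModule u s.

Definition is_Cpseries (u : nat -> C) (z s : C) : Prop :=
  @is_pseries C_AbsRing C_NormedModule u z s.

(* Main.v *)
(* Expand f in its power series and exchange the two sums: the double sum is
   absolutely convergent since |q^(jn)| <= 1.  The sum over n becomes
   G(d, t) = sum_n (B)_n t^n / (d)_n with B = b/a and t = a q^j.  It satisfies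
     (1 - t) G(d, t) = 1 + t (d - B) / (1 - d) G(dq, tq),
   and iterating this relation produces the inner series of the right-hand
   side term by term; the factors t q^n make the remainder tend to 0. *)

Require Import Defs.
From Stdlib Require Import Lra Lia IndefiniteDescription.

(** * Complex series through their partial sums *)

Fixpoint csum (u : nat -> C) (n : nat) : C :=
  match n with
  | O => 0
  | S m => csum u m + u m
  end.

Lemma sum_n_csum (u : nat -> C) (n : nat) :
  @sum_n C_AbelianMonoid u n = csum u (S n).
Proof.
  induction n as [|n IH].
  - rewrite sum_O. simpl. ring.
  - rewrite sum_Sn, IH. reflexivity.
Qed.

(** Turns complex convergence into a real limit, so that real squeeze arguments apply. The index
    shift in the proof is there because [csum u n] stops before index [n], whereas [sum_n u n]
    includes it. *)
Lemma is_Cseries_csum (u : nat -> C) (l : C) :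
  is_Cseries u l <-> is_lim_seq (fun n => Cmod (csum u n - l)) 0.
Proof.
  rewrite (is_lim_seq_incr_1 (fun n => Cmod (csum u n - l))).
  rewrite <- is_lim_seq_spec.
  etransitivity;
    [exact (filterlim_locally_ball_norm (@sum_n C_AbelianMonoid u)
              (l : C_NormedModule))|].
  assert (E : forall n, norm (minus (@sum_n C_AbelianMonoid u n) l)
                        = (Rabs (Cmod (csum u (S n) - l) - 0))%R).
  { intros n. rewrite sum_n_csum, Rminus_0_r, Rabs_pos_eq by apply Cmod_ge_0.
    reflexivity. }
  split; intros H eps; destruct (H eps) as [N HN]; exists N; intros n Hn;
    specialize (HN n Hn); unfold ball_norm in *.
  - rewrite <- E. exact HN.
  - change (norm (minus (@sum_n C_AbelianMonoid u n) l) < eps)%R.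
    rewrite E. exact HN.
Qed.

Lemma is_Cseries_unique (u : nat -> C) (l l' : C) :
  is_Cseries u l -> is_Cseries u l' -> l = l'.
Proof. exact (filterlim_locally_unique _ l l'). Qed.

Lemma is_Cseries_ext (u v : nat -> C) (l : C) :
  (forall n, u n = v n) -> is_Cseries u l -> is_Cseries v l.
Proof. exact (is_series_ext u v l). Qed.

Lemma is_Cseries_plus (u v : nat -> C) (l m : C) :
  is_Cseries u l -> is_Cseries v m -> is_Cseries (fun n => u n + v n) (l + m).
Proof. exact (is_series_plus u v l m). Qed.

Lemma is_Cseries_scal (k : C) (u : nat -> C) (l : C) :
  is_Cseries u l -> is_Cseries (fun n => k * u n) (k * l).
Proof. exact (is_series_scal k u l). Qed.

Lemma is_Cseries_0 : is_Cseries (fun _ => 0) 0.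
Proof.
  apply is_Cseries_csum. apply is_lim_seq_ext with (fun _ => 0%R).
  - intros n. assert (E : csum (fun _ => 0) n = 0).
    { induction n as [|n IH]; simpl; [|rewrite IH]; ring. }
    rewrite E. replace (0 - 0) with (RtoC 0) by ring. now rewrite Cmod_0.
  - apply is_lim_seq_const.
Qed.

Lemma is_Cseries_tail (u : nat -> C) (l : C) (n : nat) :
  is_Cseries u l -> is_Cseries (fun k => u (n + k)%nat) (l - csum u n).
Proof.
  intros H. destruct n as [|n].
  - simpl. replace (l - 0) with l by ring. exact H.
  - apply (is_series_incr_n u (S n) _ (Nat.lt_0_succ n)).
    assert (E : l = l - csum u (S n) + csum u (S n)) by ring.
    rewrite E in H. rewrite <- sum_n_csum in H at 2. exact H.
Qed.

Lemma ex_Cseries_le (u : nat -> C) (b : nat -> R) :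
  (forall n, (Cmod (u n) <= b n)%R) -> ex_series b -> exists l, is_Cseries u l.
Proof. exact (@ex_series_le C_AbsRing C_CompleteNormedModule u b). Qed.

Lemma Cmod_csum_le (u : nat -> C) (b : nat -> R) (n : nat) :
  (forall n, (Cmod (u n) <= b n)%R) -> (Cmod (csum u (S n)) <= sum_n b n)%R.
Proof.
  intros H. induction n as [|n IH].
  - rewrite sum_O. simpl. replace (0 + u 0%nat) with (u 0%nat) by ring. apply H.
  - rewrite sum_Sn. change (csum u (S (S n))) with (csum u (S n) + u (S n)).
    eapply Rle_trans; [apply Cmod_triangle|]. now apply Rplus_le_compat.
Qed.

(** The triangle inequality bounds the modulus of [l] by a partial sum of [b] plus the distance from
    a partial sum of [u] to [l]; the latter vanishes in the limit. *)
Lemma Cmod_series_le (u : nat -> C) (b : nat -> R) (l : C) (L : R) :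
  (forall n, (Cmod (u n) <= b n)%R) -> is_Cseries u l -> is_series b L ->
  (Cmod l <= L)%R.
Proof.
  intros Hb Hu HL. apply is_Cseries_csum in Hu.
  apply is_lim_seq_incr_1 in Hu.
  assert (H : is_lim_seq (fun n => sum_n b n + Cmod (csum u (S n) - l))%R (L + 0)%R)
    by (apply is_lim_seq_plus'; [exact HL | exact Hu]).
  rewrite Rplus_0_r in H.
  refine (is_lim_seq_le (fun _ => Cmod l) _ (Cmod l) L _ _ H).
  - intros n. replace l with (csum u (S n) + - (csum u (S n) - l)) at 1 by ring.
    eapply Rle_trans; [apply Cmod_triangle|]. rewrite Cmod_opp.
    apply Rplus_le_compat_r. now apply Cmod_csum_le.
  - apply is_lim_seq_const.
Qed.

Lemma series_tail_lim (b : nat -> R) (L : R) :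
  is_series b L ->
  exists tail : nat -> R,
    (forall n, is_series (fun k => b (n + k)%nat) (tail n)) /\ is_lim_seq tail 0.
Proof.
  intros H.
  (* [sum_n b m] already contains [m + 1] terms, so it is what the tail starting at [S m] leaves
     out; the tail starting at 0 is the full sum. *)
  exists (fun n => match n with O => L | S m => (L - sum_n b m)%R end). split.
  - intros [|n]; [exact H|].
    apply (is_series_incr_n b (S n) _ (Nat.lt_0_succ n)). simpl Init.Nat.pred.
    assert (E : L = (L - sum_n b n + sum_n b n)%R) by ring.
    rewrite E in H. exact H.
  - apply is_lim_seq_incr_1.
    replace (Finite 0) with (Finite (L - L)) by (f_equal; ring).
    apply is_lim_seq_minus'; [apply is_lim_seq_const | exact H].
Qed.

Lemma is_lim_seq_squeeze_0 (u v : nat -> R) :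
  (forall n, (0 <= u n <= v n)%R) -> is_lim_seq v 0 -> is_lim_seq u 0.
Proof.
  intros H Hv. apply (is_lim_seq_le_le (fun _ => 0%R) u v); auto.
  apply is_lim_seq_const.
Qed.

(** * Exchange of two summations under a product majorant *)

Lemma is_Cseries_csum_exchange (u : nat -> nat -> C) (k : nat -> C) (J : nat) :
  (forall j, is_Cseries (fun n => u n j) (k j)) ->
  is_Cseries (fun n => csum (u n) J) (csum k J).
Proof.
  intros H. induction J as [|J IH]; simpl.
  - apply is_Cseries_0.
  - now apply is_Cseries_plus.
Qed.

(** The error [s - csum k J] is the sum over [n] of the parts of the rows from column [J] on. Row
    [n] contributes at most [al n * tail J], so the error is at most [A * tail J], which tends to
    0. *)
Lemma is_Cseries_exchange (u : nat -> nat -> C) (al be : nat -> R)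
  (r k : nat -> C) (s : C) :
  (forall n j, (Cmod (u n j) <= al n * be j)%R) ->
  (forall n, (0 <= al n)%R) -> ex_series al -> ex_series be ->
  (forall n, is_Cseries (u n) (r n)) ->
  (forall j, is_Cseries (fun n => u n j) (k j)) ->
  is_Cseries r s -> is_Cseries k s.
Proof.
  intros Hb Ha [A HA] [Bs HB] Hr Hk Hs.
  destruct (series_tail_lim be Bs HB) as [tail [Ht Hlim]].
  apply is_Cseries_csum.
  apply is_lim_seq_squeeze_0 with (fun J => A * tail J)%R.
  2:{ replace (Finite 0) with (Rbar_mult A 0) by (simpl; f_equal; ring).
      now apply is_lim_seq_scal_l. }
  intros J. split; [apply Cmod_ge_0|].
  replace (csum k J - s) with (- (s + (-(1)) * csum k J)) by ring.
  rewrite Cmod_opp.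
  apply Cmod_series_le with (fun n => r n + (-(1)) * csum (u n) J)
    (fun n => tail J * al n)%R.
  - intros n. rewrite Rmult_comm.
    replace (r n + _) with (r n - csum (u n) J) by ring.
    apply Cmod_series_le with (fun j => u n (J + j)%nat)
      (fun j => al n * be (J + j)%nat)%R.
    + intros j. apply Hb.
    + now apply is_Cseries_tail.
    + exact (is_series_scal (al n) _ _ (Ht J)).
  - apply is_Cseries_plus; [exact Hs|].
    apply is_Cseries_scal. now apply is_Cseries_csum_exchange.
  - rewrite Rmult_comm. exact (is_series_scal (tail J) _ _ HA).
Qed.

(** * Geometric majorants from ratio bounds *)

(** Induction on the rank from which the ratio bound holds: dropping the first term lowers this rank
    by one, and the constant is then enlarged to cover the dropped term. *)
Lemma geometric_bound (v : nat -> R) (rho : R) :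
  (0 < rho)%R -> eventually (fun n => v (S n) <= rho * v n)%R ->
  exists K, (forall n, v n <= K * rho ^ n)%R.
Proof.
  intros Hr [N HN]. revert v HN. induction N as [|N IH]; intros v HN.
  - exists (v 0%nat). intros n. induction n as [|n IHn]; simpl.
    + lra.
    + specialize (HN n (Nat.le_0_l n)).
      apply (Rmult_le_compat_l rho) in IHn; lra.
  - destruct (IH (fun n => v (S n))) as [K HK].
    { intros n Hn. apply HN. lia. }
    exists (Rmax (v 0%nat) (K / rho)). intros [|n].
    + simpl. rewrite Rmult_1_r. apply Rmax_l.
    + eapply Rle_trans; [apply HK|]. simpl.
      replace (K * rho ^ n)%R with (K / rho * (rho * rho ^ n))%R by (field; lra).
      apply Rmult_le_compat_r; [|apply Rmax_r].
      apply Rmult_le_pos; [lra | apply pow_le; lra].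
Qed.

(** Ratio test in the form used for [qratio] and [qcoef], where an explicit majorant [r] of the
    ratios has a known limit below [rho]. *)
Lemma geometric_bound_ratio (v r : nat -> R) (rho : R) :
  (forall n, 0 <= v n)%R -> (0 < rho)%R ->
  eventually (fun n => v (S n) <= r n * v n)%R ->
  eventually (fun n => r n < rho)%R ->
  exists K, (forall n, v n <= K * rho ^ n)%R.
Proof.
  intros Hv Hrho H1 H2. apply geometric_bound; [exact Hrho|].
  generalize (filter_and _ _ H1 H2). apply filter_imp. intros n [Ha Hb].
  eapply Rle_trans; [exact Ha|]. apply Rmult_le_compat_r; [apply Hv | lra].
Qed.

Lemma ex_series_geometric (K rho : R) :
  (0 < rho < 1)%R -> ex_series (fun n => K * rho ^ n)%R.
Proof.
  intros H. apply (ex_series_scal K (fun n => rho ^ n)%R). apply ex_series_geom.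
  rewrite Rabs_pos_eq; lra.
Qed.

Lemma is_lim_seq_eventually_lt (u : nat -> R) (l m : R) :
  is_lim_seq u l -> (l < m)%R -> eventually (fun n => u n < m)%R.
Proof.
  intros H Hlm. apply is_lim_seq_spec in H.
  assert (He : (0 < m - l)%R) by lra.
  destruct (H (mkposreal _ He)) as [N HN]. exists N. intros n Hn.
  specialize (HN n Hn). simpl in HN. apply Rabs_def2 in HN. lra.
Qed.

Lemma is_lim_seq_geom_scal (k r : R) :
  (0 <= r < 1)%R -> is_lim_seq (fun n => k * r ^ n)%R 0.
Proof.
  intros Hr. replace (Finite 0) with (Rbar_mult k 0) by (simpl; f_equal; ring).
  apply is_lim_seq_scal_l. apply is_lim_seq_geom. rewrite Rabs_pos_eq; lra.
Qed.

(** * Modulus estimates and nonvanishing of q-Pochhammer factors *)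

Lemma Cmod_1_minus_le (x : C) : (Cmod (1 - x) <= 1 + Cmod x)%R.
Proof.
  eapply Rle_trans; [apply Cmod_triangle|]. rewrite Cmod_opp, Cmod_1. lra.
Qed.

Lemma Cmod_1_minus_ge (x : C) : (1 - Cmod x <= Cmod (1 - x))%R.
Proof.
  assert (H := Cmod_triangle (1 - x) x).
  replace (1 - x + x) with (RtoC 1) in H by ring. rewrite Cmod_1 in H. lra.
Qed.

Lemma one_minus_neq_0 (x : C) : (Cmod x < 1)%R -> 1 - x <> 0.
Proof. intros H. apply Cmod_gt_0. assert (K := Cmod_1_minus_ge x). lra. Qed.

Lemma Cmod_pow_le_1 (q : C) (n : nat) : (Cmod q < 1)%R -> (Cmod (q ^ n) <= 1)%R.
Proof.
  intros H. rewrite Cmod_pow, <- (pow1 n). apply pow_incr.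
  split; [apply Cmod_ge_0 | lra].
Qed.

Lemma Cmod_mult_pow_lt_1 (t q : C) (n : nat) :
  (Cmod q < 1)%R -> (Cmod t < 1)%R -> (Cmod (t * q ^ n) < 1)%R.
Proof.
  intros Hq Ht. rewrite Cmod_mult.
  assert (H := Cmod_pow_le_1 q n Hq). assert (H0 := Cmod_ge_0 t).
  apply (Rmult_le_compat_l (Cmod t)) in H; lra.
Qed.

(** The recursion peels off the last factor; peeling off the first one instead is what links the
    parameter [d] to [d * q]. *)
Lemma qpoch_shift (x q : C) (n : nat) :
  qpoch x q (S n) = (1 - x) * qpoch (x * q) q n.
Proof.
  induction n as [|n IH].
  - simpl. ring.
  - change (qpoch x q (S (S n))) with (qpoch x q (S n) * (1 - x * q ^ S n)).
    rewrite IH. simpl. ring.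
Qed.

Lemma qpoch_factor_neq_0 (x q : C) :
  (forall n, qpoch x q n <> 0) -> forall n, 1 - x * q ^ n <> 0.
Proof.
  intros H n E. apply (H (S n)). simpl. rewrite E. ring.
Qed.

Lemma qpoch_neq_0 (x q : C) :
  (forall n, 1 - x * q ^ n <> 0) -> forall n, qpoch x q n <> 0.
Proof.
  intros H n. induction n as [|n IH]; simpl.
  - apply C1_nz.
  - now apply Cmult_neq_0.
Qed.

Lemma qpoch_pow_shift_neq_0 (x q : C) (N : nat) :
  (forall n, qpoch x q n <> 0) -> forall n, qpoch (x * q ^ N) q n <> 0.
Proof.
  intros H. apply qpoch_neq_0. intros n.
  replace (x * q ^ N * q ^ n) with (x * q ^ (N + n)) by (rewrite Cpow_add_r; ring).
  now apply qpoch_factor_neq_0.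
Qed.

(** * The series G(d, t): convergence and contiguous relation *)

Definition qratio (q B d t : C) (n : nat) : C :=
  qpoch B q n * t ^ n / qpoch d q n.

Lemma qratio_S (q B d t : C) (n : nat) :
  (forall n, qpoch d q n <> 0) ->
  qratio q B d t (S n)
  = t * (1 - B * q ^ n) / (1 - d * q ^ n) * qratio q B d t n.
Proof.
  intros H. unfold qratio. simpl. field. split.
  - apply H.
  - now apply qpoch_factor_neq_0.
Qed.

(** The ratio of consecutive terms tends in modulus to [Cmod t], so the midpoint between [Cmod t]
    and 1 serves as [rho]. *)
Lemma qratio_bound (q B d t : C) :
  (Cmod q < 1)%R -> (Cmod t < 1)%R -> (forall n, qpoch d q n <> 0) ->
  exists K rho, (0 < rho < 1)%R
    /\ forall n, (Cmod (qratio q B d t n) <= K * rho ^ n)%R.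
Proof.
  intros Hq Ht Hd.
  assert (Hq0 := Cmod_ge_0 q). assert (Ht0 := Cmod_ge_0 t).
  pose (r := fun n => (Cmod t * (1 + Cmod B * Cmod q ^ n)
                        / (1 - Cmod d * Cmod q ^ n))%R).
  assert (Hlim : is_lim_seq r (Cmod t * (1 + 0) / (1 - 0))%R).
  { apply is_lim_seq_div'; [| |lra].
    - apply is_lim_seq_mult'; [apply is_lim_seq_const|].
      apply is_lim_seq_plus'; [apply is_lim_seq_const|].
      now apply is_lim_seq_geom_scal.
    - apply is_lim_seq_minus'; [apply is_lim_seq_const|].
      now apply is_lim_seq_geom_scal. }
  destruct (geometric_bound_ratio (fun n => Cmod (qratio q B d t n)) r
              ((1 + Cmod t) / 2) (fun n => Cmod_ge_0 _)) as [K HK].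
  - lra.
  (* The denominator of [r n] bounds the true one from below usefully only when it is positive,
     which holds from some rank on. *)
  - assert (Hs := is_lim_seq_eventually_lt _ 0 1
                    (is_lim_seq_geom_scal (Cmod d) (Cmod q) (conj Hq0 Hq)) Rlt_0_1).
    revert Hs. apply filter_imp. intros n Hn.
    rewrite qratio_S by exact Hd.
    rewrite Cmod_mult, Cmod_div, Cmod_mult by now apply qpoch_factor_neq_0.
    apply Rmult_le_compat_r; [apply Cmod_ge_0|].
    assert (H1 := Cmod_1_minus_le (B * q ^ n)).
    assert (H2 := Cmod_1_minus_ge (d * q ^ n)).
    rewrite Cmod_mult, Cmod_pow in H1, H2.
    apply Rmult_le_compat.
    + apply Rmult_le_pos; apply Cmod_ge_0.
    + left. apply Rinv_0_lt_compat. lra.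
    + now apply Rmult_le_compat_l.
    + apply Rinv_le_contravar; lra.
  - eapply is_lim_seq_eventually_lt; [exact Hlim|]. lra.
  - exists K, ((1 + Cmod t) / 2)%R. split; [lra | exact HK].
Qed.

Lemma ex_Cseries_qratio (q B d t : C) :
  (Cmod q < 1)%R -> (Cmod t < 1)%R -> (forall n, qpoch d q n <> 0) ->
  exists s, is_Cseries (qratio q B d t) s.
Proof.
  intros Hq Ht Hd. destruct (qratio_bound q B d t Hq Ht Hd) as [K [rho [Hr HK]]].
  apply (ex_Cseries_le _ _ HK). now apply ex_series_geometric.
Qed.

(* With [x n] and [y n] the terms of the two series,
   [x (n + 1) = t * x n + t * (d - B) / (1 - d) * y n]. *)
Lemma qratio_contiguous (q B d t s s' : C) :
  (forall n, qpoch d q n <> 0) ->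
  is_Cseries (qratio q B d t) s -> is_Cseries (qratio q B (d * q) (t * q)) s' ->
  (1 - t) * s = 1 + t * (d - B) / (1 - d) * s'.
Proof.
  intros Hd Hs Hs'.
  assert (Hd1 : 1 - d <> 0).
  { replace d with (d * q ^ 0) by (simpl; ring). now apply qpoch_factor_neq_0. }
  assert (Hd' : forall n, qpoch (d * q) q n <> 0).
  { intros n E. apply (Hd (S n)). rewrite qpoch_shift, E. ring. }
  (* The term of index 0 is 1, so the shifted series sums to [s - 1]; the termwise relation gives a
     second value for its sum. *)
  assert (E : s - 1 = t * s + t * (d - B) / (1 - d) * s').
  2:{ replace ((1 - t) * s) with (s - 1 - t * s + 1) by ring. rewrite E. ring. }
  apply (is_Cseries_unique (fun n => qratio q B d t (1 + n))).
  - replace (s - 1) with (s - csum (qratio q B d t) 1).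
    + now apply is_Cseries_tail.
    + unfold qratio. simpl. field.
  - apply is_Cseries_ext with
      (fun n => t * qratio q B d t n
                + t * (d - B) / (1 - d) * qratio q B (d * q) (t * q) n).
    + intros n. assert (Ef := qpoch_factor_neq_0 d q Hd n).
      change (1 + n)%nat with (S n). rewrite qratio_S by exact Hd.
      (* With everything over [qpoch d q n], the relation reduces to [(1 - d * q ^ n) + (d - B) * q
         ^ n = 1 - B * q ^ n]. *)
      assert (Es : qpoch (d * q) q n = qpoch d q n * (1 - d * q ^ n) / (1 - d)).
      { change (qpoch d q n * (1 - d * q ^ n)) with (qpoch d q (S n)).
        rewrite qpoch_shift. field. exact Hd1. }
      unfold qratio. rewrite Es, Cpow_mult_l. field. repeat split; auto.
    + now apply is_Cseries_plus; apply is_Cseries_scal.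
Qed.

(** * Iteration of the contiguous relation and its remainder *)

(** Closed form of the product over [k < n] of the multipliers [t * q ^ k * (d * q ^ k - B) / ((1 -
    d * q ^ k) * (1 - t * q ^ k))] produced by the iteration. Dividing by one more factor
    [1 - t * q ^ n] gives the term of the target series. *)
Definition qcoef (q B d t : C) (n : nat) : C :=
  qpoch (d / B) q n * (- (B * t)) ^ n * q ^ (n * (n - 1) / 2)
    / (qpoch d q n * qpoch t q n).

(** No parity argument is required: the numerator grows by the exact multiple [n * 2] of the
    divisor. *)
Lemma triangular_S (n : nat) : (S n * (S n - 1) / 2 = n * (n - 1) / 2 + n)%nat.
Proof.
  replace (S n * (S n - 1))%nat with (n * (n - 1) + n * 2)%nat
    by (destruct n; simpl; rewrite ?Nat.sub_0_r; ring).
  now rewrite Nat.div_add by lia.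
Qed.

Lemma qcoef_S (q B d t : C) (n : nat) :
  B <> 0 -> (forall n, qpoch d q n <> 0) -> (forall n, qpoch t q n <> 0) ->
  qcoef q B d t (S n)
  = t * q ^ n * (d * q ^ n - B) / ((1 - d * q ^ n) * (1 - t * q ^ n))
    * qcoef q B d t n.
Proof.
  intros HB Hd Ht. unfold qcoef. rewrite triangular_S, Cpow_add_r.
  cbn [qpoch Cpow]. field.
  repeat split; auto; now apply qpoch_factor_neq_0.
Qed.

(** The ratio carries a factor [q ^ n] and tends to 0, so any geometric rate in (0, 1) is available;
    1/2 is taken. *)
Lemma qcoef_lim (q B d t : C) :
  B <> 0 -> (Cmod q < 1)%R -> (Cmod t < 1)%R -> (forall n, qpoch d q n <> 0) ->
  (forall n, qpoch t q n <> 0) ->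
  is_lim_seq (fun n => Cmod (qcoef q B d t n)) 0.
Proof.
  intros HB Hq Ht Hd Htn.
  assert (Hq0 := Cmod_ge_0 q). assert (Ht0 := Cmod_ge_0 t).
  assert (Hd0 := Cmod_ge_0 d). assert (HB0 := Cmod_ge_0 B).
  pose (r := fun n => (Cmod t * (Cmod d + Cmod B) * Cmod q ^ n
                        / ((1 - Cmod d * Cmod q ^ n) * (1 - Cmod t * Cmod q ^ n)))%R).
  assert (Hlim : is_lim_seq r (0 / ((1 - 0) * (1 - 0)))%R).
  { apply is_lim_seq_div'; [| |lra].
    - now apply is_lim_seq_geom_scal.
    - apply is_lim_seq_mult'; (apply is_lim_seq_minus'; [apply is_lim_seq_const|]);
        now apply is_lim_seq_geom_scal. }
  destruct (geometric_bound_ratio (fun n => Cmod (qcoef q B d t n)) r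
              (1 / 2) (fun n => Cmod_ge_0 _)) as [K HK].
  - lra.
  - assert (Hs := is_lim_seq_eventually_lt _ 0 1
                    (is_lim_seq_geom_scal (Cmod d) (Cmod q) (conj Hq0 Hq)) Rlt_0_1).
    revert Hs. apply filter_imp. intros n Hn.
    assert (Htn1 := Cmod_mult_pow_lt_1 t q n Hq Ht).
    assert (Hqn := Cmod_pow_le_1 q n Hq).
    assert (H1 := Cmod_1_minus_ge (d * q ^ n)).
    assert (H2 := Cmod_1_minus_ge (t * q ^ n)).
    assert (H3 : (Cmod (d * q ^ n - B) <= Cmod d + Cmod B)%R).
    { eapply Rle_trans; [apply Cmod_triangle|]. rewrite Cmod_opp, Cmod_mult.
      apply Rplus_le_compat_r. rewrite <- (Rmult_1_r (Cmod d)) at 2.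
      now apply Rmult_le_compat_l. }
    rewrite Cmod_mult, Cmod_pow in H1, H2. rewrite Cmod_mult, Cmod_pow in Htn1.
    rewrite qcoef_S by assumption.
    rewrite Cmod_mult, Cmod_div
      by (apply Cmult_neq_0; now apply qpoch_factor_neq_0).
    rewrite !Cmod_mult, Cmod_pow.
    apply Rmult_le_compat_r; [apply Cmod_ge_0|]. unfold r.
    apply Rmult_le_compat.
    + repeat apply Rmult_le_pos; try apply Cmod_ge_0. now apply pow_le.
    + left. apply Rinv_0_lt_compat. apply Rmult_lt_0_compat; lra.
    + replace (Cmod t * (Cmod d + Cmod B) * Cmod q ^ n)%R
        with (Cmod t * Cmod q ^ n * (Cmod d + Cmod B))%R by ring.
      apply Rmult_le_compat_l; [|exact H3].
      apply Rmult_le_pos; [exact Ht0 | now apply pow_le].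
    + apply Rinv_le_contravar; [apply Rmult_lt_0_compat; lra|].
      apply Rmult_le_compat; lra.
  - eapply is_lim_seq_eventually_lt; [exact Hlim|]. lra.
  - apply is_lim_seq_squeeze_0 with (fun n => K * (1 / 2) ^ n)%R.
    + intros n. split; [apply Cmod_ge_0 | apply HK].
    + apply is_lim_seq_geom_scal. lra.
Qed.

(** For large [N] all ratios of consecutive terms have modulus at most 1/2, uniformly in [n], and
    the first term is 1; hence the bound 2, the sum of the powers of 1/2. *)
Lemma qratio_sum_bound (q B d t : C) (G : nat -> C) :
  (Cmod q < 1)%R -> (Cmod t < 1)%R -> (forall n, qpoch d q n <> 0) ->
  (forall N, is_Cseries (qratio q B (d * q ^ N) (t * q ^ N)) (G N)) ->
  eventually (fun N => (Cmod (G N) <= 2)%R).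
Proof.
  intros Hq Ht Hd HG.
  assert (Hq0 := Cmod_ge_0 q). assert (Ht0 := Cmod_ge_0 t).
  assert (Hd0 := Cmod_ge_0 d). assert (HB0 := Cmod_ge_0 B).
  (* The threshold 1/2 keeps the denominators of the ratios at least 1/2, and 1/4 keeps their
     numerators below 1/4. *)
  assert (E1 := is_lim_seq_eventually_lt _ 0 (1 / 2)
                  (is_lim_seq_geom_scal (Cmod d) (Cmod q) (conj Hq0 Hq)) ltac:(lra)).
  assert (E2 := is_lim_seq_eventually_lt _ 0 (1 / 4)
                  (is_lim_seq_geom_scal (1 + Cmod B) (Cmod q) (conj Hq0 Hq))
                  ltac:(lra)).
  generalize (filter_and _ _ E1 E2). apply filter_imp. intros N [H1 H2].
  assert (Hs : is_series (fun n => (1 / 2) ^ n)%R 2%R).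
  { assert (Hg := is_series_geom (1 / 2) ltac:(rewrite Rabs_pos_eq; lra)).
    replace (/ (1 - 1 / 2))%R with 2%R in Hg by field. exact Hg. }
  refine (Cmod_series_le _ _ _ _ _ (HG N) Hs).
  assert (HdN := qpoch_pow_shift_neq_0 d q N Hd).
  intros n. induction n as [|n IH].
  - unfold qratio. simpl. replace (1 * 1 / 1) with (RtoC 1) by field.
    rewrite Cmod_1. lra.
  - rewrite qratio_S by exact HdN. rewrite Cmod_mult. simpl.
    apply Rmult_le_compat; try apply Cmod_ge_0; [|exact IH].
    rewrite Cmod_div, Cmod_mult by now apply qpoch_factor_neq_0.
    assert (Hqn := Cmod_pow_le_1 q n Hq).
    assert (Hge := Cmod_1_minus_ge (d * q ^ N * q ^ n)).
    assert (Hle := Cmod_1_minus_le (B * q ^ n)).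
    rewrite !Cmod_mult, Cmod_pow in Hge. rewrite Cmod_mult in Hle.
    rewrite Cmod_mult, (Cmod_pow q N).
    set (x := Cmod (q ^ n)) in *. set (y := (Cmod q ^ N)%R) in *.
    assert (Hx : (0 <= x)%R) by apply Cmod_ge_0.
    assert (Hy : (0 <= y)%R) by now apply pow_le.
    assert (Hdy : (0 <= Cmod d * y)%R) by now apply Rmult_le_pos.
    assert (Hden : (1 / 2 <= Cmod (1 - d * q ^ N * q ^ n))%R) by nra.
    assert (Hnum : (Cmod (1 - B * q ^ n) <= 1 + Cmod B)%R) by nra.
    assert (Hn0 := Cmod_ge_0 (1 - B * q ^ n)).
    apply Rle_div_l; [lra|].
    assert (Cmod t * y * Cmod (1 - B * q ^ n) <= (1 + Cmod B) * y)%R.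
    { rewrite (Rmult_comm _ y). apply Rle_trans with (1 * y * (1 + Cmod B))%R; [|lra].
      apply Rmult_le_compat; try nra. }
    lra.
Qed.

(* Iterating [qratio_contiguous] N times leaves the first N terms of the target
   series plus the remainder [qcoef N * G N], which tends to 0. *)
Lemma qratio_transformation (q B d t s : C) :
  B <> 0 -> (Cmod q < 1)%R -> (Cmod t < 1)%R -> (forall n, qpoch d q n <> 0) ->
  is_Cseries (qratio q B d t) s ->
  is_Cseries
    (fun n => qpoch (d / B) q n * (- (B * t)) ^ n * q ^ (n * (n - 1) / 2)
                / (qpoch d q n * qpoch t q (n + 1))) s.
Proof.
  intros HB Hq Ht Hd Hs.
  assert (Htn : forall n, qpoch t q n <> 0).
  { apply qpoch_neq_0. intros n. apply one_minus_neq_0.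
    now apply Cmod_mult_pow_lt_1. }
  (* Sums are given by a relation, so choice collects the values G(d q^N, t q^N) into a sequence. *)
  destruct (functional_choice (fun N g => is_Cseries (qratio q B (d * q ^ N) (t * q ^ N)) g))
    as [G HG].
  { intros N. apply ex_Cseries_qratio; [exact Hq | now apply Cmod_mult_pow_lt_1 |].
    now apply qpoch_pow_shift_neq_0. }
  assert (HG0 : G 0%nat = s).
  { apply (is_Cseries_unique (qratio q B d t)); [|exact Hs].
    assert (H := HG 0%nat). simpl in H. rewrite !Cmult_1_r in H. exact H. }
  assert (HGS : forall N, (1 - t * q ^ N) * G N
      = 1 + t * q ^ N * (d * q ^ N - B) / (1 - d * q ^ N) * G (S N)).
  { intros N. apply (qratio_contiguous q);
      [now apply qpoch_pow_shift_neq_0 | apply HG |].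
    replace (d * q ^ N * q) with (d * q ^ S N) by (simpl; ring).
    replace (t * q ^ N * q) with (t * q ^ S N) by (simpl; ring). apply HG. }
  apply is_Cseries_ext with (fun n => qcoef q B d t n / (1 - t * q ^ n)).
  { intros n. unfold qcoef. rewrite Nat.add_1_r. cbn [qpoch]. field.
    repeat split; auto. now apply qpoch_factor_neq_0. }
  assert (Hsum : forall N, s
    = csum (fun n => qcoef q B d t n / (1 - t * q ^ n)) N + qcoef q B d t N * G N).
  { intros N. induction N as [|N IH].
    - rewrite HG0. unfold qcoef. simpl. field.
    - rewrite IH at 1. cbn [csum]. rewrite qcoef_S by assumption.
      assert (N1 := qpoch_factor_neq_0 d q Hd N).
      assert (N2 := qpoch_factor_neq_0 t q Htn N).
      (* Multiplying and dividing by [1 - t * q ^ N] lets [HGS] apply: its constant 1 yields term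
         [N], the rest the next remainder. *)
      replace (G N) with ((1 - t * q ^ N) * G N / (1 - t * q ^ N))
        by (field; exact N2).
      rewrite HGS. field. now split. }
  apply is_Cseries_csum.
  assert (Hlim : is_lim_seq (fun n => 2 * Cmod (qcoef q B d t n))%R 0).
  { replace (Finite 0) with (Rbar_mult 2 0) by (simpl; f_equal; ring).
    apply is_lim_seq_scal_l. now apply qcoef_lim. }
  refine (is_lim_seq_le_le_loc (fun _ => 0%R) _ _ _ _ (is_lim_seq_const 0) Hlim).
  generalize (qratio_sum_bound q B d t G Hq Ht Hd HG). apply filter_imp.
  intros N HN. split; [apply Cmod_ge_0|].
  rewrite (Hsum N) at 1.
  match goal with |- (Cmod ?x <= _)%R =>
    replace x with (- (qcoef q B d t N * G N)) by ring end.
  rewrite Cmod_opp, Cmod_mult, Rmult_comm.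
  apply Rmult_le_compat_r; [apply Cmod_ge_0 | exact HN].
Qed.

(** * Absolute convergence of power series *)

Lemma pow_n_Cpow (z : C) (n : nat) : @pow_n C_Ring z n = z ^ n.
Proof. induction n as [|n IH]; simpl; [|rewrite IH]; reflexivity. Qed.

Lemma is_Cpseries_Cpow (lambda : nat -> C) (z s : C) :
  is_Cpseries lambda z s -> is_Cseries (fun j => lambda j * z ^ j) s.
Proof.
  apply is_Cseries_ext. intros j. rewrite pow_n_Cpow. apply Cmult_comm.
Qed.

(** A term is the difference of two consecutive deviations of the partial sums from the limit, and
    these deviations are bounded. *)
Lemma is_Cseries_bounded (u : nat -> C) (l : C) :
  is_Cseries u l -> exists M, forall n, (Cmod (u n) <= M)%R.
Proof.
  intros H. apply is_Cseries_csum in H.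
  destruct (filterlim_bounded _ (ex_intro _ 0%R H)) as [M HM].
  exists (M + M)%R. intros n.
  replace (u n) with ((csum u (S n) - l) + - (csum u n - l)) by (simpl; ring).
  eapply Rle_trans; [apply Cmod_triangle|]. rewrite Cmod_opp.
  apply Rplus_le_compat; (eapply Rle_trans; [apply Rle_abs|]; apply HM).
Qed.

(** Abel's lemma: the terms at [z] are bounded, so those at [c] are dominated by a geometric series
    of ratio [Cmod c / Cmod z]. *)
Lemma ex_series_Cmod_power_series (lambda : nat -> C) (c z s : C) :
  (Cmod c < Cmod z)%R -> is_Cpseries lambda z s ->
  ex_series (fun j => Cmod (lambda j * c ^ j)).
Proof.
  intros Hcz H. apply is_Cpseries_Cpow in H.
  destruct (is_Cseries_bounded _ _ H) as [M HM].
  assert (Hc := Cmod_ge_0 c).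
  assert (Hr : (0 <= Cmod c / Cmod z < 1)%R).
  { split; [apply Rdiv_le_0_compat; lra | apply Rlt_div_l; lra]. }
  apply (@ex_series_le R_AbsRing R_CompleteNormedModule)
    with (fun j => M * (Cmod c / Cmod z) ^ j)%R.
  - intros j. change (norm (Cmod (lambda j * c ^ j)))
      with (Rabs (Cmod (lambda j * c ^ j))).
    rewrite Rabs_pos_eq by apply Cmod_ge_0.
    replace (Cmod (lambda j * c ^ j))
      with (Cmod (lambda j * z ^ j) * (Cmod c / Cmod z) ^ j)%R.
    + apply Rmult_le_compat_r; [apply pow_le; lra | apply HM].
    + rewrite !Cmod_mult, !Cmod_pow. unfold Rdiv.
      rewrite Rpow_mult_distr, pow_inv. field. apply pow_nonzero. lra.
  - apply (ex_series_scal M (fun j => (Cmod c / Cmod z) ^ j)%R).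
    apply ex_series_geom. rewrite Rabs_pos_eq; lra.
Qed.

(** * Expansion of f and assembly of the identity *)

(** Division is total in the code, so the nonvanishing hypotheses give [b / a], [a * d / b] and the
    quotients by [qpoch d q n] their usual meaning. The witnesses express convergence of every
    series along with the equality. *)
Theorem theorem2p1 (q a b c d : C) (f : C -> C) (lambda : nat -> C)
  (hq : (Cmod q < 1)%R) (ha : (Cmod a < 1)%R) (hc : (Cmod c < 1)%R)
  (ha0 : a <> 0) (hb0 : b <> 0)
  (hd : forall n : nat, qpoch d q n <> 0)
  (hf : forall z : C, (Cmod z < 1)%R -> is_Cpseries lambda z (f z)) :
  exists (inner : nat -> C) (s : C),
    (forall j : nat,
       is_Cseries
         (fun n : nat =>
            qpoch (a * d / b) q n * (- b) ^ n
              * q ^ (n * (n - 1) / 2 + j * n)%nat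
              / (qpoch d q n * qpoch (a * q ^ j) q (n + 1)))
         (inner j))
    /\ is_Cseries
         (fun n : nat =>
            qpoch (b / a) q n * a ^ n / qpoch d q n * f (c * q ^ n)) s
    /\ is_Cseries (fun j : nat => lambda j * c ^ j * inner j) s.
Proof.
  assert (haq : forall j, (Cmod (a * q ^ j) < 1)%R)
    by (intros j; now apply Cmod_mult_pow_lt_1).
  assert (hcq : forall n, (Cmod (c * q ^ n) < 1)%R)
    by (intros n; now apply Cmod_mult_pow_lt_1).
  assert (hba : b / a <> 0).
  { intros E. apply hb0. replace b with (b / a * a) by (field; exact ha0).
    rewrite E. ring. }
  (* [inner j] is introduced as G(d, a q^j), the value that the exchange produces; the
     transformation identifies it with the stated inner series. *)
  destruct (functional_choice (fun j g => is_Cseries (qratio q (b / a) d (a * q ^ j)) g))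
    as [inner Hinner].
  { intros j. now apply ex_Cseries_qratio. }
  set (A := qratio q (b / a) d a).
  destruct (qratio_bound q (b / a) d a hq ha hd) as [K [rho [Hrho HK]]].
  assert (HA : ex_series (fun n => Cmod (A n))).
  { apply (@ex_series_le R_AbsRing R_CompleteNormedModule)
      with (fun n => K * rho ^ n)%R.
    - intros n. change (norm (Cmod (A n))) with (Rabs (Cmod (A n))).
      rewrite Rabs_pos_eq by apply Cmod_ge_0. apply HK.
    - now apply ex_series_geometric. }
  assert (Hmu : ex_series (fun j => Cmod (lambda j * c ^ j))).
  { assert (Hc0 := Cmod_ge_0 c).
    (* The midpoint between [Cmod c] and 1 lies in the unit disc and beyond [c] in modulus. *)
    assert (Hz : Cmod ((1 + Cmod c) / 2)%R = ((1 + Cmod c) / 2)%R)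
      by (rewrite Cmod_R, Rabs_pos_eq; lra).
    apply (ex_series_Cmod_power_series _ _ ((1 + Cmod c) / 2)%R
             (f ((1 + Cmod c) / 2)%R)).
    - rewrite Hz. lra.
    - apply hf. rewrite Hz. lra. }
  assert (Hrow : forall n, is_Cseries
      (fun j => A n * (lambda j * c ^ j * (q ^ n) ^ j)) (A n * f (c * q ^ n))).
  { intros n. apply is_Cseries_scal.
    apply is_Cseries_ext with (fun j => lambda j * (c * q ^ n) ^ j).
    - intros j. rewrite Cpow_mult_l. ring.
    - apply is_Cpseries_Cpow. apply hf, hcq. }
  assert (Hbd : forall n j, (Cmod (A n * (lambda j * c ^ j * (q ^ n) ^ j))
                             <= Cmod (A n) * Cmod (lambda j * c ^ j))%R).
  { intros n j. rewrite (Cmod_mult (A n)), (Cmod_mult (lambda j * c ^ j)).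
    apply Rmult_le_compat_l; [apply Cmod_ge_0|].
    rewrite <- (Rmult_1_r (Cmod (lambda j * c ^ j))) at 2.
    apply Rmult_le_compat_l; [apply Cmod_ge_0|].
    rewrite <- Cpow_mult_r. now apply Cmod_pow_le_1. }
  assert (Hs : exists s, is_Cseries (fun n => A n * f (c * q ^ n)) s).
  { destruct Hmu as [L HL].
    (* Summing the majorant of row [n] over [j] bounds the [n]-th term of the left-hand series by
       [L * Cmod (A n)]. *)
    apply ex_Cseries_le with (fun n => L * Cmod (A n))%R.
    - intros n. apply (Cmod_series_le _ _ _ _ (Hbd n) (Hrow n)).
      rewrite Rmult_comm. exact (is_series_scal (Cmod (A n)) _ _ HL).
    - exact (ex_series_scal L _ HA). }
  destruct Hs as [s Hs]. exists inner, s. split; [|split].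
  - intros j.
    eapply is_Cseries_ext;
      [|apply (qratio_transformation q (b / a) d (a * q ^ j)); auto].
    (* With [B = b / a] and [t = a * q ^ j], the [n]-th power of [- (B * t)] supplies both
       [(- b) ^ n] and the factor [q ^ (j * n)]. *)
    intros n. replace (d / (b / a)) with (a * d / b) by (field; auto).
    replace (- (b / a * (a * q ^ j))) with (- b * q ^ j) by (field; auto).
    rewrite Cpow_mult_l, Cpow_add_r, Cpow_mult_r. unfold Cdiv. ring.
  - exact Hs.
  - refine (is_Cseries_exchange _ _ _ _ _ _ Hbd (fun n => Cmod_ge_0 _) HA Hmu
              Hrow _ Hs).
    intros j. apply is_Cseries_ext with
      (fun n => lambda j * c ^ j * qratio q (b / a) d (a * q ^ j) n).
    (* The factor [(q ^ n) ^ j] is absorbed into the argument: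
       [a ^ n * (q ^ n) ^ j = (a * q ^ j) ^ n]. *)
    + intros n. unfold A, qratio.
      rewrite Cpow_mult_l, <- !Cpow_mult_r, (Nat.mul_comm n j). unfold Cdiv. ring.
    + now apply is_Cseries_scal.
Qed.
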